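(* Let $G_F$ be the graph of the 12 contiguous regions of France, i.e. the simple graph with vertex set $\{\mathrm{HDF},\mathrm{NOR},\mathrm{BRE},\mathrm{PDL},\mathrm{CVL},\mathrm{IDF},\mathrm{GES},\mathrm{BFC},\mathrm{NAQ},\mathrm{OCC},\mathrm{ARA},\mathrm{PAC}\}$ and the 23 edges HDF–NOR, HDF–IDF, HDF–GES, NOR–IDF, NOR–CVL, NOR–PDL, NOR–BRE, BRE–PDL, PDL–CVL, PDL–NAQ, CVL–IDF, CVL–BFC, CVL–ARA, CVL–NAQ, IDF–GES, IDF–BFC, GES–BFC, BFC–ARA, ARA–NAQ, ARA–OCC, ARA–PAC, NAQ–OCC, OCC–PAC. Then the number of proper colorings of $G_F$ with $4$ colors is $\chi(G_F,4)=5184$.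
   Context: For a finite simple graph $G$ and a positive integer $t$, $\chi(G,t)$ denotes the number of maps $f:V(G)\to C$, where $C$ is a fixed set of $t$ colors, with $f(u)\neq f(v)$ whenever $\{u,v\}$ is an edge of $G$ (proper colorings, not counted up to any symmetry). The vertices stand for the 12 contiguous regions of metropolitan France: HDF = Hauts-de-France, NOR = Normandie, BRE = Bretagne, PDL = Pays de la Loire, CVL = Centre-Val de Loire, IDF = Île-de-France, GES = Grand Est, BFC = Bourgogne-Franche-Comté, NAQ = Nouvelle-Aquitaine, OCC = Occitanie, ARA = Auvergne-Rhône-Alpes, PAC = Provence-Alpes-Côte d'Azur. Two regions are adjacent if they share a border of positive length. *)

(* Defs.v *)
From HB Require Import structures.
From mathcomp Require Import all_boot.

Set Implicit Arguments.
Unset Strict Implicit.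
Unset Printing Implicit Defensive.

Record sgraph := SGraph {
  vertex : finType;
  adj : rel vertex;
  adj_sym : symmetric adj;
  adj_irrefl : irreflexive adj
}.

Definition proper (G : sgraph) (t : nat) (f : {ffun vertex G -> 'I_t}) : bool :=
  [forall u, forall v, adj u v ==> (f u != f v)].

(* The set of t colours is 'I_t. *)
Definition chi (G : sgraph) (t : nat) : nat :=
  #|[set f : {ffun vertex G -> 'I_t} | proper f]|.

Inductive region :=
  | HDF (* Hauts-de-France *)
  | NOR (* Normandie *)
  | BRE (* Bretagne *)
  | PDL (* Pays de la Loire *)
  | CVL (* Centre-Val de Loire *)
  | IDF (* Ile-de-France *)
  | GES (* Grand Est *)
  | BFC (* Bourgogne-Franche-Comte *)
  | NAQ (* Nouvelle-Aquitaine *)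
  | OCC (* Occitanie *)
  | ARA (* Auvergne-Rhone-Alpes *)
  | PAC (* Provence-Alpes-Cote d'Azur *).

Definition regions : seq region :=
  [:: HDF; NOR; BRE; PDL; CVL; IDF; GES; BFC; NAQ; OCC; ARA; PAC].

Definition region_code (r : region) : nat :=
  match r with
  | HDF => 0 | NOR => 1 | BRE => 2 | PDL => 3 | CVL => 4 | IDF => 5
  | GES => 6 | BFC => 7 | NAQ => 8 | OCC => 9 | ARA => 10 | PAC => 11
  end.

Lemma region_codeK : cancel region_code (nth HDF regions).
Proof. by case. Qed.

HB.instance Definition _ := Countable.copy region (can_type region_codeK).

Lemma regions_enumP : Finite.axiom regions.
Proof. by case. Qed.

HB.instance Definition _ := isFinite.Build region regions_enumP.

(* Each border is listed once, in one orientation. *)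
Definition french_borders : seq (region * region) :=
  [:: (HDF, NOR); (HDF, IDF); (HDF, GES);
      (NOR, IDF); (NOR, CVL); (NOR, PDL); (NOR, BRE);
      (BRE, PDL);
      (PDL, CVL); (PDL, NAQ);
      (CVL, IDF); (CVL, BFC); (CVL, ARA); (CVL, NAQ);
      (IDF, GES); (IDF, BFC);
      (GES, BFC);
      (BFC, ARA);
      (ARA, NAQ); (ARA, OCC); (ARA, PAC);
      (NAQ, OCC);
      (OCC, PAC)].

Definition french_adj : rel region :=
  fun u v => ((u, v) \in french_borders) || ((v, u) \in french_borders).

Lemma french_adj_sym : symmetric french_adj.
Proof. by move=> u v; rewrite /french_adj orbC. Qed.

Lemma french_adj_irrefl : irreflexive french_adj.
Proof. by case. Qed.

Definition G_F : sgraph := SGraph french_adj_sym french_adj_irrefl.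

(* Main.v *)
Require Import Defs.
From mathcomp Require Import all_boot.

(** The proper colorings of the subgraph induced on a list of vertices are
    enumerated, one vertex at a time, as the lists of the colors taken along
    it; for a list of all the vertices this reduces [chi] to computing the
    length of a list. *)

Section ColoringEnumeration.

Variables (G : sgraph) (t : nat).
Implicit Types (v : vertex G) (s : seq (vertex G)) (g : vertex G -> nat).

(* The [let] lets the adjacency tests be evaluated once for all the lists [w]. *)
Fixpoint colorings s : seq (seq nat) :=
  if s is v :: s' then
    let nbr := [seq adj v u | u <- s'] in
    [seq c :: w | w <- colorings s', c <- [seq c <- iota 0 t | c \notin mask nbr w]]
  else [:: [::]].

(** Taking [g] total and [nat]-valued avoids induced subgraphs and dependent types in inductions on
    [s]; its values off [s] are arbitrary. *)
Definition proper_on s g : Prop :=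
  {in s, forall v, g v < t} /\ {in s &, forall u v, adj u v -> g u != g v}.

(** The mask commutes with [map g] and amounts to filtering [s] by [adj v], so it keeps exactly the
    colors of the neighbors of [v] in [s]. *)
Lemma notin_mask_colorP v s g c :
  reflect {in s, forall u, adj v u -> c != g u}
          (c \notin mask [seq adj v u | u <- s] (map g s)).
Proof.
rewrite -map_mask -filter_mask; apply: (iffP idP) => [c_new u us vu | H].
  by apply: contraNneq c_new => ->; apply: map_f; rewrite mem_filter vu.
apply/mapP => -[u]; rewrite mem_filter => /andP[vu us] c_eq.
by move: (H u us vu); rewrite c_eq eqxx.
Qed.

Lemma uniq_colorings s : uniq (colorings s).
Proof.
elim: s => [|v s IHs] //=; apply: allpairs_uniq_dep => //.
  by move=> w _; apply/filter_uniq/iota_uniq.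
by move=> [w c] [w' c'] _ _ /= [-> ->].
Qed.

Lemma proper_on_coloring s g : proper_on s g -> map g s \in colorings s.
Proof.
elim: s => [|v s IHs] //= [g_lt g_adj].
apply/allpairsPdep; exists (map g s), (g v); split=> //.
  apply: IHs; split=> [u us | u u' us us'].
    by apply: g_lt; rewrite inE us orbT.
  by apply: g_adj; rewrite inE ?us ?us' orbT.
rewrite mem_filter mem_iota add0n /= g_lt ?mem_head // andbT.
by apply/notin_mask_colorP => u us; apply: g_adj; rewrite inE ?eqxx ?us ?orbT.
Qed.

Lemma coloring_proper_on s w :
  uniq s -> w \in colorings s -> exists2 g, proper_on s g & w = map g s.
Proof.
elim: s w => [|v s IHs] w /=.
  by rewrite inE => _ /eqP->; exists (fun=> 0).
case/andP=> vNs /IHs{}IHs /allpairsPdep[_ [c [/IHs[g [g_lt g_adj] ->]]]].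
rewrite mem_filter mem_iota add0n /= => /andP[/notin_mask_colorP vc c_lt ->].
(* Recolor [v] by [c]: since [s] does not contain [v], the colors along [s] are unchanged. *)
pose h u := if u == v then c else g u.
have hs u : u \in s -> h u = g u.
  by rewrite /h; case: eqP => // -> us; rewrite us in vNs.
have hv : h v = c by rewrite /h eqxx.
exists h; last by rewrite /= hv; congr (_ :: _); apply/eq_in_map => u /hs.
split=> [u | u u']; first by rewrite inE => /predU1P[->|us]; rewrite ?hv ?hs ?g_lt.
rewrite !inE => /predU1P[->|us] /predU1P[->|us']; rewrite ?hv ?hs //.
- by rewrite adj_irrefl.
- exact: vc.
- by rewrite adj_sym eq_sym; apply: vc.
- exact: g_adj.
Qed.

(** Reading colors along [s] is injective because [s] covers all vertices, and its image is
    [colorings s]. Both lists are duplicate-free, so their sizes agree. *)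
Lemma chi_colorings s :
  uniq s -> (forall v, v \in s) -> chi G t = size (colorings s).
Proof.
move=> s_uniq sT; pose code (f : {ffun vertex G -> 'I_t}) := [seq val (f v) | v <- s].
have code_inj : injective code.
  by move=> f f' /eq_in_map ff'; apply/ffunP => v; apply/val_inj/ff'.
rewrite /chi cardE -(size_map code); apply/perm_size/uniq_perm.
- by rewrite map_inj_uniq // enum_uniq.
- exact: uniq_colorings.
move=> w; apply/mapP/idP => [[f] | /(coloring_proper_on _ _ s_uniq)[g [g_lt g_adj] ->]].
  rewrite mem_enum inE => /forallP f_proper ->; apply: proper_on_coloring.
  by split=> [v _ | u v _ _]; [exact: ltn_ord | apply/implyP/(forallP (f_proper u))].
exists [ffun v => Ordinal (g_lt v (sT v))]; last by apply: eq_map => v; rewrite ffunE.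
rewrite mem_enum inE; apply/forallP => u; apply/forallP => v.
by apply/implyP => uv; rewrite !ffunE -val_eqE; apply: g_adj.
Qed.

End ColoringEnumeration.

Theorem mainTheorem3 : chi G_F 4 = 5184.
Proof.
have regionsT : forall v : vertex G_F, v \in regions by case.
rewrite (@chi_colorings G_F 4 regions isT regionsT).
(* In boolean form the equation evaluates to [true] instead of leaving two large unary numerals. *)
by apply/eqP; vm_compute.
Qed.
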